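(* Let $S,R\in\mathcal A_c$ and suppose that $f\colon S\to R$ is a betweenness isomorphism. Then $f$ extends to a unique scaled isometry $\Phi\colon\mathbb R^2\to\mathbb R^2$ (that is, there is exactly one scaled isometry $\Phi$ of $\mathbb R^2$ with $\Phi|_S=f$).
   Context: $\mathcal A_c$ is the family of all subsets of $\mathbb R^2$ that are the union of two distinct concentric circles, i.e. sets of the form $S(c,\rho)\cup S(c,\rho')$ with $c\in\mathbb R^2$ and $0<\rho<\rho'$, where $S(c,\rho)$ denotes the circle (curve) with center $c$ and radius $\rho$. For $u,v\in\mathbb R^2$, $[u,v]=\{\lambda u+(1-\lambda)v:\lambda\in[0,1]\}$. For $A,B\subseteq\mathbb R^2$, a betweenness isomorphism from $A$ to $B$ is a bijection $f\colon A\to B$ such that for all $x,y,z\in A$: $f(x)\in[f(y),f(z)]$ if and only if $x\in[y,z]$. A scaled isometry is a map $\Phi\colon\mathbb R^2\to\mathbb R^2$ for which there exists $C>0$ such that $\|\Phi(x)-\Phi(y)\|=C\|x-y\|$ for all $x,y\in\mathbb R^2$ (Euclidean norm). *)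

(* Defs.v *)
From mathcomp Require Import all_boot all_order all_algebra.
From mathcomp Require Import all_classical all_reals.

Set Implicit Arguments.
Unset Strict Implicit.
Unset Printing Implicit Defensive.

Import Order.TTheory GRing.Theory Num.Theory.

Local Open Scope classical_set_scope.
Local Open Scope ring_scope.

(* Euclidean norm; the norm `|u| that MathComp-Analysis puts on row vectors
   is the sup norm. *)
Definition enorm (R : realType) n (u : 'rV[R]_n) : R :=
  Num.sqrt (\sum_i u 0 i ^+ 2).

Definition circle (R : realType) (c : 'rV[R]_2) (rho : R) : set 'rV[R]_2 :=
  [set p | enorm (p - c) = rho].

Definition concentric_circles (R : realType) : set (set 'rV[R]_2) :=
  [set S | exists (c : 'rV[R]_2) (rho rho' : R),
     [/\ 0 < rho, rho < rho' & S = circle c rho `|` circle c rho']].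

Definition segment (R : realType) n (u v : 'rV[R]_n) : set 'rV[R]_n :=
  [set lambda *: u + (1 - lambda) *: v | lambda in [set t : R | 0 <= t <= 1]].

(* A map from A to B is represented by a function on the whole plane, of which
   only the values on A are constrained. *)
Definition betweenness_isomorphism (R : realType) (A B : set 'rV[R]_2)
    (f : 'rV[R]_2 -> 'rV[R]_2) : Prop :=
  set_bij A B f /\
  forall x y z, A x -> A y -> A z ->
    (segment (f y) (f z) (f x) <-> segment y z x).

Definition scaled_isometry (R : realType) (Phi : 'rV[R]_2 -> 'rV[R]_2) : Prop :=
  exists2 C : R, 0 < C &
    forall x y, enorm (Phi x - Phi y) = C * enorm (x - y).

(* Main.v *)
Require Import Defs.
From mathcomp Require Import all_boot all_order all_algebra.
From mathcomp Require Import all_classical all_reals all_analysis.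
From mathcomp Require Import complex ring lra.

(** The plane is identified with the complex numbers, and both circles of a
    pair with the circle U of complex numbers of modulus 1, by z |-> c + r z
    and z |-> c + r' z.  Put k = r / r'.

    An outer point is never strictly between two points of the pair, while an
    inner point lies strictly inside an outer diameter.  Hence a
    betweenness isomorphism maps outer points to outer points and inner points
    to inner points, and so induces two bijections g and h of U.  A line through
    the outer points A, B and the inner points P, Q is described by
    A B = P Q and A + B = k (P + Q), so g and h transport this relation for
    k to the same relation for the ratio k' of the image pair
    ([circle_pair_iso]).

    Two outer points see an inner point on their chord exactly when they are at
    angular distance at least 2 th, where cos th = k.  The arcs of radius 2 th
    generate the topology of the circle, hence g is continuous ([iso_close]).
    Tangent chords join outer points at angular distance 2 th; by continuity g
    turns the rotation by 2 th into a rotation ([iso_rotation]), and h is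
    a rotated copy of g.  Secants meeting both circles then say that
    H(u) = g(m e^(iu)) g(m e^(-iu)) satisfies
    H(u) = H(v + th) whenever cos u = k cos v.  The map v |-> u - th
    moves every v in (0, pi/2] strictly towards 0, so that the continuous
    function H is constant ([chord_mean_constant]).  Constancy of H for all
    m means that g(x) g(y) depends only on x y: up to the factor g(1), g is a
    continuous injective endomorphism of the group U, thus the identity
    or the conjugation ([circle_morphism]).  Finally the tangent chords give
    k = k' and h = g ([iso_rigid]), so f is the restriction of a similarity.

    Uniqueness holds because a point of the plane is determined by its
    distances to the points of a circle ([scaled_isometry_unique]). *)

Set Implicit Arguments.
Unset Strict Implicit.
Unset Printing Implicit Defensive.

Import Order.TTheory GRing.Theory Num.Theory.
Import numFieldNormedType.Exports.

Local Open Scope classical_set_scope.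
Local Open Scope ring_scope.
Local Open Scope complex_scope.

(** * The circle of unit complex numbers *)

Section UnitCircle.
Variable R : realType.
Implicit Types (z : R[i]) (a b t : R).

Definition unitc z := complex.Re z ^+ 2 + complex.Im z ^+ 2 = 1.

(** A copy of the conjugation fixed at the type [R[i] -> R[i]], so that it is
    printed and matched in one way only. *)
Definition cconj z : R[i] := z^*.

Definition cis t : R[i] := cos t +i* sin t.

Lemma unitc_cis t : unitc (cis t).
Proof. exact: cos2Dsin2. Qed.

Lemma unitc_neq0 z : unitc z -> z != 0.
Proof.
move=> uz; apply/eqP => z0; move: uz; rewrite /unitc z0 /= expr0n /= addr0.
by move/eqP; rewrite eq_sym oner_eq0.
Qed.

(** Conjugation is inversion on the unit circle; computations with conjugates
    thereby become identities between rational fractions. *)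
Lemma unitcV z : unitc z -> z^-1 = cconj z.
Proof.
move=> uz; apply: (mulfI (unitc_neq0 uz)); rewrite mulfV ?unitc_neq0//.
case: z uz => a b; rewrite /unitc /cconj /= => uz; simpc; apply/eqP.
by rewrite eq_complex /=; apply/andP; split; apply/eqP; rewrite -?uz; ring.
Qed.

Lemma unitc_ReV z : unitc z -> complex.Re z^-1 = complex.Re z.
Proof. by move=> /unitcV ->; case: z. Qed.

Lemma unitc_ImV z : unitc z -> complex.Im z^-1 = - complex.Im z.
Proof. by move=> /unitcV ->; case: z. Qed.

Lemma unitc_inv z : unitc z -> unitc z^-1.
Proof. by move=> uz; rewrite /unitc unitc_ReV// unitc_ImV// sqrrN. Qed.

Lemma unitc_mul z w : unitc z -> unitc w -> unitc (z * w).
Proof.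
rewrite /unitc; case: z => a b; case: w => c d /= ab cd.
transitivity ((a ^+ 2 + b ^+ 2) * (c ^+ 2 + d ^+ 2)); first by ring.
by rewrite ab cd mulr1.
Qed.

Lemma unitc_div z w : unitc z -> unitc w -> unitc (z / w).
Proof. by move=> uz uw; apply: unitc_mul => //; apply: unitc_inv. Qed.

Lemma cisD a b : cis (a + b) = cis a * cis b.
Proof.
rewrite /cis cosD sinD; simpc; congr (_ +i* _).
by ring.
Qed.

Lemma cis0 : cis 0 = 1.
Proof. by rewrite /cis cos0 sin0. Qed.

Lemma cis_neq0 t : cis t != 0.
Proof. exact/unitc_neq0/unitc_cis. Qed.

Lemma cisN t : cis (- t) = (cis t)^-1.
Proof. by rewrite unitcV; [rewrite /cconj /cis cosN sinN | exact: unitc_cis]. Qed.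

Lemma cisB a b : cis (a - b) = cis a / cis b.
Proof. by rewrite cisD cisN. Qed.

Lemma cis_cos t : cis t + (cis t)^-1 = (2 * cos t)%:C.
Proof.
by rewrite -cisN /cis cosN sinN; simpc; congr (_ +i* _); rewrite mulr2n mulrDl !mul1r.
Qed.

Lemma cispi : cis pi = -1.
Proof. by rewrite /cis cospi sinpi; simpc. Qed.

Lemma cis2pi : cis (pi + pi) = 1.
Proof. by rewrite cisD cispi mulrNN mulr1. Qed.

Lemma unitc_cisP z : unitc z -> exists2 t, - pi <= t <= pi & z = cis t.
Proof.
case: z => a b; rewrite /unitc /= => ab.
have ha : -1 <= a <= 1.
  by rewrite -ler_norml -(@ler_pXn2r _ 2) ?nnegrE// real_normK ?num_real//
    expr1n -ab lerDl sqr_ge0.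
have := acos_ge0 ha; have := acos_lepi ha; move=> le_pi ge0.
have ca : cos (acos a) = a by apply: acosK; rewrite in_itv.
have sa : sin (acos a) ^+ 2 = b ^+ 2 by rewrite sin2cos2 ca -ab; ring.
move/eqP: sa; rewrite eqf_sqr => /orP[] /eqP sb.
  exists (acos a); last by rewrite /cis ca sb.
  by rewrite le_pi andbT; lra.
exists (- acos a); last by rewrite /cis cosN sinN ca sb opprK.
by lra.
Qed.

End UnitCircle.

(** * Lines through both circles *)

Section Chord.
Variable R : realType.
Implicit Types (A B P Q : R[i]) (k : R).

(** The inner point k P lies on the chord from A to B; A B / P is then the
    second intersection Q of the chord with the inner circle, so this says
    that [A, B] and [k P, k Q] have the same midpoint, while A B = P Q says that
    they have the same direction. *)
Definition chord k A B P := A + B = k%:C * (P + A * B / P).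

Lemma realcM (a b : R) : (a * b)%:C = a%:C * b%:C.
Proof. by simpc. Qed.

Lemma cconjM (x y : R[i]) : cconj (x * y) = cconj x * cconj y.
Proof. exact: rmorphM. Qed.

Lemma cconjD (x y : R[i]) : cconj (x + y) = cconj x + cconj y.
Proof. exact: rmorphD. Qed.

Lemma cconjB (x y : R[i]) : cconj (x - y) = cconj x - cconj y.
Proof. exact: rmorphB. Qed.

Lemma cconjV (x : R[i]) : cconj (x^-1) = (cconj x)^-1.
Proof. exact: fmorphV. Qed.

Lemma cconj_real (a : R) : cconj a%:C = a%:C.
Proof. exact: conjc_real. Qed.

Lemma realc_eq0 (a : R) : (a%:C == 0) = (a == 0).
Proof. by rewrite eq_complex /= eqxx andbT. Qed.

(** Both pairs of points are symmetric about the direction m, at the common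
    distance cos u from the centre. *)
Lemma chord_cis k m u v :
  chord k (cis (m + u)) (cis (m - u)) (cis (m + v)) <-> cos u = k * cos v.
Proof.
rewrite /chord !cisB !cisD.
have mu := cis_neq0 m; have uu := cis_neq0 u; have vu := cis_neq0 v.
have -> : cis m * cis u + cis m / cis u = cis m * (cis u + (cis u)^-1).
  by rewrite mulrDr.
have -> : cis m * cis v + cis m * cis u * (cis m / cis u) / (cis m * cis v)
   = cis m * (cis v + (cis v)^-1).
  by field; rewrite mu uu vu.
rewrite !cis_cos mulrCA -realcM; split=> [/(mulfI mu)[]|->]; first by lra.
by congr (_ * _%:C); ring.
Qed.

Lemma chord_other k A B P : A != 0 -> B != 0 -> P != 0 ->
  chord k A B P -> chord k A B (A * B / P).
Proof.
move=> A0 B0 P0; rewrite /chord => ->; congr (_ * _); field.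
by rewrite A0 B0 P0.
Qed.

(** P and Q are the two roots of k X^2 - (A + B) X + k A B. *)
Lemma chord_pair k A B P Q : k != 0 -> P != 0 -> Q != 0 -> P != Q ->
  chord k A B P -> chord k A B Q -> A * B = P * Q.
Proof.
move=> k0 P0 Q0 PQ; rewrite /chord => -> /mulfI.
rewrite realc_eq0 => /(_ k0) E.
have QP : Q - P != 0 by rewrite subr_eq0 eq_sym.
apply: (mulfI QP); apply/eqP; rewrite -subr_eq0; apply/eqP.
transitivity ((P + A * B / P - (Q + A * B / Q)) * (P * Q)).
  by field; rewrite P0 Q0.
by rewrite E subrr mul0r.
Qed.

(** Writing the endpoints of a chord as m + u and m - u exhibits its normal
    direction m and its angular half-width u. *)
Lemma unitc_half A B : unitc A -> unitc B ->
  exists m u, A = cis (m + u) /\ B = cis (m - u).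
Proof.
move=> /unitc_cisP[a _ ->] /unitc_cisP[b _ ->].
by exists ((a + b) / 2), ((a - b) / 2); split; congr cis; field.
Qed.

Lemma Re_cis_double u : complex.Re (cis (u + u) : R[i]) = 2 * cos u ^+ 2 - 1.
Proof. by rewrite /cis /= cosD -!expr2 sin2cos2; ring. Qed.

(** With A = m + u and B = m - u, an inner point exists iff |cos u| <= k, that
    is iff the chord is at distance at most k from the centre. *)
Lemma chordE k A B : 0 < k -> unitc A -> unitc B ->
  (exists2 P, unitc P & chord k A B P) <->
  complex.Re (A / B) <= 2 * k ^+ 2 - 1.
Proof.
move=> k0 uA uB; have [m [u [-> ->]]] := unitc_half uA uB.
have -> : cis (m + u) / cis (m - u) = cis (u + u).
  by rewrite -cisB; congr cis; ring.
rewrite Re_cis_double; split=> [[P /unitc_cisP[t _ ->]]|le].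
  rewrite -[t](subrKC m) => /chord_cis ->.
  by have := sin2cos2 (t - m); have := sqr_ge0 (sin (t - m)); nra.
have le1 : -1 <= cos u / k <= 1.
  rewrite -ler_norml -(@ler_pXn2r _ 2) ?nnegrE// real_normK ?num_real//.
  by rewrite expr1n expr_div_n ler_pdivrMr ?exprn_gt0// mul1r; lra.
exists (cis (m + acos (cos u / k))); first exact: unitc_cis.
apply/chord_cis; rewrite acosK ?in_itv//=; field.
by rewrite gt_eqF.
Qed.

(** If the relation holds, (k P - B) / (A - B) is invariant under conjugation,
    hence real: k P lies on the line through A and B. *)
Lemma chord_segment k A B P : 0 < k < 1 -> unitc A -> unitc B -> unitc P ->
  chord k A B P <->
  exists2 l : R, 0 <= l <= 1 & k%:C * P = l%:C * A + (1 - l)%:C * B.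
Proof.
move=> /andP[k0 k1] uA uB uP.
have A0 := unitc_neq0 uA; have B0 := unitc_neq0 uB; have P0 := unitc_neq0 uP.
have AJ := esym (unitcV uA); have BJ := esym (unitcV uB); have PJ := esym (unitcV uP).
have lE (l : R) : (1 - l)%:C = 1 - l%:C by simpc.
have EJ (l : R) : k%:C * P = l%:C * A + (1 - l%:C) * B ->
    k%:C / P = l%:C / A + (1 - l%:C) / B.
  move=> E; have := congr1 (@cconj R) E.
  by rewrite -lE cconjD !cconjM AJ BJ PJ !cconj_real.
split=> [H|[l _]]; last first.
  rewrite lE => E; rewrite /chord.
  transitivity (k%:C * P + (k%:C / P) * (A * B)); last by field.
  by rewrite (EJ _ E) E; field; rewrite A0 B0.
have AB : A != B.
  apply: contraTneq isT => AB; have : exists2 P, unitc P & chord k A B P by exists P.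
  by move/(chordE k0 uA uB); rewrite AB divff//=; nra.
have BA0 : A - B != 0 by rewrite subr_eq0.
pose z := (k%:C * P - B) / (A - B).
have zJ : cconj z = z.
  rewrite /z cconjM cconjV !cconjB cconjM AJ BJ PJ cconj_real.
  have -> : k%:C * P - B = A - k%:C * A * B / P.
    apply/eqP; rewrite -subr_eq0; apply/eqP.
    transitivity (k%:C * (P + A * B / P) - (A + B)); first by field.
    by rewrite -H subrr.
  by field; rewrite A0 B0 P0 BA0 /= mulN1r subr_eq0 eq_sym.
pose l := complex.Re z.
have lz : l%:C = z by move: zJ; rewrite /l; case: (z) => x y [] ?; congr (_ +i* _); lra.
have E : k%:C * P = l%:C * A + (1 - l%:C) * B by rewrite lz /z; field.
exists l; last by rewrite lE.
(* The squared length of an affine combination of two unit vectors is at least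
   1 if its coefficient is outside [0, 1], but here it is k^2 < 1. *)
have := uA; rewrite -[A](mulfVK B0); set c := A / B => _.
have uc : unitc c by exact: unitc_div.
have c2 : c + c^-1 = (2 * complex.Re c)%:C.
  rewrite (unitcV uc); case: (c) => x y; rewrite /cconj; simpc.
  by congr (_ +i* _); rewrite /= mulr2n mulrDl !mul1r.
have : (k ^+ 2)%:C = (1 - l * (1 - l) * (2 - 2 * complex.Re c))%:C.
  transitivity ((k%:C * P) * (k%:C / P)); first by rewrite expr2 realcM; field.
  transitivity (1 - l%:C * (1 - l%:C) * (1 + 1 - (c + c^-1))).
    by rewrite (EJ _ E) E /c; field; rewrite A0 B0.
  by rewrite c2; simpc; congr (_ +i* _); ring.
move=> []; have := uc; rewrite /unitc.
move: (complex.Re c) (complex.Im c) => x y xy Ek.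
have x1 : x <= 1 by have := sqr_ge0 y; nra.
have k2 : k ^+ 2 < 1 by nra.
have : 0 < l * (1 - l) * (2 - 2 * x) by lra.
have x2 : 0 <= 2 - 2 * x by lra.
move=> pos; have {pos}ll : 0 < l * (1 - l).
  by rewrite ltNge; apply/negP => /mulr_le0_ge0 /(_ x2); lra.
have [l0|l0] := ltP l 0; first by nra.
by have [l1|l1] := ltP 1 l; [nra | lra].
Qed.
End Chord.

(** * Continuity of the induced map *)

Section Continuity.
Variable R : realType.
Implicit Types (A B P Q : R[i]) (k : R).

(** What remains of a betweenness isomorphism between two pairs of concentric
    circles of ratios k and k', read on the unit circle: g on the outer
    circle and h on the inner one. *)
Record circle_pair_iso k k' (g h : R[i] -> R[i]) : Prop := CirclePairIso {
  iso_ratio : 0 < k < 1;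
  iso_ratio' : 0 < k' < 1;
  iso_outer : forall A, unitc A -> unitc (g A);
  iso_inner : forall P, unitc P -> unitc (h P);
  iso_outer_inj : forall A B, unitc A -> unitc B -> g A = g B -> A = B;
  iso_outer_surj : forall A, unitc A -> exists2 B, unitc B & g B = A;
  iso_inner_inj : forall P Q, unitc P -> unitc Q -> h P = h Q -> P = Q;
  iso_inner_surj : forall P, unitc P -> exists2 Q, unitc Q & h Q = P;
  iso_chord : forall A B P, unitc A -> unitc B -> unitc P ->
    chord k A B P <-> chord k' (g A) (g B) (h P) }.

(** Angles t and t + s, for s <> 0, are separated by the arc cos > kappa around 0.
    Rotated copies of this arc hence separate the points of the circle. *)
Lemma separation kappa s : -1 < kappa < 1 -> - pi <= s <= pi -> s != 0 ->
  exists t : R, cos t < kappa < cos (t + s).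
Proof.
move=> hk; wlog s0 : s / 0 < s.
  move=> H hs sn0; have [s0|s0|s0] := ltgtP s 0.
  - have [|||t ht] := H (- s); [lra|lra|by rewrite oppr_eq0|].
    by exists (- t); rewrite cosN (_ : - t + s = - (t - s)) ?cosN//; ring.
  - exact: H.
  - by rewrite s0 eqxx in sn0.
move=> hs _; pose T : R := acos kappa.
have T0 : 0 < T by apply: acos_gt0; lra.
have Tpi : T < pi by apply: acos_ltpi; lra.
have cT : cos T = kappa by apply: acosK; rewrite in_itv/=; lra.
have lt_cos (x y : R) : 0 <= x -> x < y -> y <= pi -> cos y < cos x.
  by move=> ? ? ?; rewrite ltr_cos// in_itv/=; lra.
rewrite -cT; (* T is the angular radius of the arc: rotate the second point to its centre
   if s > T, and otherwise move the first point slightly outside. *)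
have [sT|sT] := ltP T s.
  by exists (- s); rewrite addNr cosN; apply/andP; split; apply: lt_cos; lra.
pose x := T + Num.min s (pi - T) / 2.
have [x1 x2 x3] : [/\ T < x, x <= pi & x - s < T].
  by rewrite /x; have [le|le] := leP s (pi - T); split; lra.
exists (- x); rewrite cosN (_ : - x + s = - (x - s)) ?cosN; last by ring.
by apply/andP; split; apply: lt_cos; lra.
Qed.

(** The angular distance of A and B decides whether their chord meets the inner
    circle; so g maps arcs of one fixed radius to arcs of one fixed radius. *)
Lemma iso_far k k' g h : circle_pair_iso k k' g h ->
  forall A B, unitc A -> unitc B ->
  complex.Re (A / B) <= 2 * k ^+ 2 - 1 <->
  complex.Re (g A / g B) <= 2 * k' ^+ 2 - 1.
Proof.
case=> /andP[k0 _] /andP[k'0 _] uG uH _ _ _ sH cG A B uA uB.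
rewrite -(chordE k0 uA uB) -(chordE k'0 (uG _ uA) (uG _ uB)).
split=> [[P uP]|[P uP]].
  by move/(cG _ _ _ uA uB uP); exists (h P) => //; exact: uH.
have [Q uQ <-] := sH _ uP.
by move/(cG _ _ _ uA uB uQ); exists Q.
Qed.

Definition ccontinuous (F : R -> R[i]) :=
  continuous (fun t => complex.Re (F t)) /\ continuous (fun t => complex.Im (F t)).

Lemma ccontinuous_cis : ccontinuous (@cis R).
Proof. by split=> t; [exact: continuous_cos | exact: continuous_sin]. Qed.

Lemma ccontinuous_cst z : ccontinuous (fun=> z).
Proof. by split=> t; exact: cvg_cst. Qed.

Lemma ccontinuousM F G : ccontinuous F -> ccontinuous G ->
  ccontinuous (fun t => F t * G t).
Proof.
move=> [F1 F2] [G1 G2]; split.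
- rewrite (_ : (fun=> _) = fun t => complex.Re (F t) * complex.Re (G t) -
      complex.Im (F t) * complex.Im (G t)); last first.
    by apply/funext => t /=; case: (F t) (G t) => ? ? [].
  move=> t; apply: cvgB; apply: cvgM; [exact: F1|exact: G1|exact: F2|exact: G2].
- rewrite (_ : (fun=> _) = fun t => complex.Re (F t) * complex.Im (G t) +
      complex.Im (F t) * complex.Re (G t)); last first.
    by apply/funext => t /=; case: (F t) (G t) => ? ? [].
  move=> t; apply: cvgD; apply: cvgM; [exact: F1|exact: G2|exact: F2|exact: G1].
Qed.

Lemma ccontinuousV F : (forall t, unitc (F t)) -> ccontinuous F ->
  ccontinuous (fun t => (F t)^-1).
Proof.
move=> uF [F1 F2]; split.
- rewrite (_ : (fun=> _) = fun t => complex.Re (F t))//.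
  by apply/funext => t /=; rewrite unitc_ReV.
- rewrite (_ : (fun=> _) = fun t => - complex.Im (F t)); last first.
    by apply/funext => t /=; rewrite unitc_ImV.
  by move=> t; apply: cvgN; exact: F2.
Qed.

Lemma ccontinuous_comp F (u : R -> R) : ccontinuous F -> continuous u ->
  ccontinuous (F \o u).
Proof.
move=> [F1 F2] cu; split=> t.
- exact: (continuous_comp (cu t) (F1 (u t))).
- exact: (continuous_comp (cu t) (F2 (u t))).
Qed.

Lemma near_lt (f : R -> R) (x c : R) : {for x, continuous f} -> f x < c ->
  \forall y \near x, f y < c.
Proof. by move=> cf fx; apply: (cvgr_lt _ cf). Qed.

Lemma near_gt (f : R -> R) (x c : R) : {for x, continuous f} -> c < f x ->
  \forall y \near x, c < f y.
Proof. by move=> cf fx; apply: (cvgr_gt _ cf). Qed.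

(** The points at distance at least e from g(t0) form a compact set W.  Each
    of them has a neighbourhood that is excluded, for t near t0, as a value of g
    by an arc which contains g(t0); finitely many of these neighbourhoods
    cover W. *)
Lemma iso_close k k' g h : circle_pair_iso k k' g h -> forall (t0 e : R), 0 < e ->
  \forall t \near t0, 1 - e < complex.Re (g (cis t) / g (cis t0)).
Proof.
move=> iso t0 e e0; have [kk kk' uG uH iG sG _ _ _] := iso.
have ux t : unitc (g (cis t)) by apply/uG/unitc_cis.
pose W := `[- pi, pi]%classic `&` [set s : R | cos s <= 1 - e].
have cW : compact W.
  apply: compact_closedI; first exact: segment_compact.
  apply: (@preimage_closed _ _ (@cos R) [set x | x <= 1 - e]) => [s _|].
    exact: continuous_cos.
  exact: closed_le.
have near_cover : \forall t \near t0, W `<=` [set s | g (cis t) <> g (cis t0) * cis s].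
  move/compact_near_coveringP : cW => /(_ R (nbhs t0)
    (fun t s => g (cis t) <> g (cis t0) * cis s) _); apply => s [/=].
  rewrite in_itv/= => hs cs.
  have s0 : s != 0 by apply/eqP => s0; move: cs; rewrite s0 cos0; lra.
  have hk : -1 < 2 * k' ^+ 2 - 1 < 1 by move: kk' => /andP[? ?]; nra.
  have [t1 /andP[t1l t1r]] := separation hk hs s0.
  (* The point g b is the centre of an arc that contains g (cis t0), but not
     the candidate value g (cis t0) * cis s. *)
  have [b ub gb] := sG (g (cis t0) * cis s * cis t1)
    (unitc_mul (unitc_mul (ux t0) (unitc_cis s)) (unitc_cis t1)).
  have bt0 : 2 * k ^+ 2 - 1 < complex.Re (b / cis t0).
    rewrite ltNge; apply/negP => /(iso_far iso ub (unitc_cis _)).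
    rewrite gb.
    rewrite (_ : _ / _ = cis (t1 + s)); last by rewrite cisD; field; apply/unitc_neq0.
    by rewrite /=; lra.
  have bs : \forall s' \near s, cos (s - s' + t1) < 2 * k' ^+ 2 - 1.
    apply: (near_lt (f := fun x => cos (s - x + t1))); last by rewrite subrr add0r.
    apply: (@continuous_comp _ _ _ (fun x : R => s - x + t1)); last exact: continuous_cos.
    by apply: cvgD; [apply: cvgB; [exact: cvg_cst|exact: cvg_id]|exact: cvg_cst].
  have bt : \forall t \near t0, 2 * k ^+ 2 - 1 < complex.Re (b / cis t).
    apply: (near_gt (f := fun t => complex.Re (b / cis t))) => //.
    have [+ _] := ccontinuousM (ccontinuous_cst b)
      (ccontinuousV (@unitc_cis R) ccontinuous_cis).
    exact.
  near=> s' t => /= E.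
  have : 2 * k ^+ 2 - 1 < complex.Re (b / cis t) by near: t; exact: bt.
  rewrite ltNge => /negP; apply.
  apply/(iso_far iso ub (unitc_cis _)); rewrite gb E.
  rewrite (_ : _ / _ = cis (s - s' + t1)); last first.
    rewrite cisD cisB; field.
    by rewrite cis_neq0; apply/unitc_neq0.
  by rewrite /=; apply: ltW; near: s'; exact: bs.
near=> t.
have [s hs E] := unitc_cisP (unitc_div (ux t) (ux t0)).
rewrite E /= ltNge; apply/negP => cs.
have : W s by split; rewrite //= in_itv.
have /[apply] : W `<=` [set s | g (cis t) <> g (cis t0) * cis s].
  by near: t; exact: near_cover.
by apply; rewrite -E mulrC divfK// unitc_neq0.
Unshelve. all: end_near.
Qed.

End Continuity.

(** * Consequences of continuity *)

Section Descent.
Variable R : realType.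

(** For unit complex numbers |z - w|^2 = 2 (1 - Re (z / w)). *)
Lemma close_ccontinuous (F : R -> R[i]) : (forall t, unitc (F t)) ->
  (forall t0 e : R, 0 < e ->
     \forall t \near t0, 1 - e < complex.Re (F t / F t0)) ->
  ccontinuous F.
Proof.
move=> uF cF.
have dist t t0 : (complex.Re (F t) - complex.Re (F t0)) ^+ 2 +
    (complex.Im (F t) - complex.Im (F t0)) ^+ 2 =
    2 * (1 - complex.Re (F t / F t0)).
  have := uF t; have := uF t0; rewrite (unitcV (uF t0)) /unitc.
  by case: (F t) (F t0) => a b [c d] /=; lra.
have sqr_lt (x e : R) : 0 < e -> x ^+ 2 < e ^+ 2 -> `|x| < e.
  by move=> e0; rewrite -ltr_sqrt ?exprn_gt0// !sqrtr_sqr (gtr0_norm e0).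
split=> t0; apply/cvgrPdist_lt => e e0;
  near=> t; apply: sqr_lt => //;
  have : 1 - e ^+ 2 / 2 < complex.Re (F t / F t0)
    by near: t; apply: cF; rewrite divr_gt0// exprn_gt0.
- move=> close; rewrite -[ltLHS]sqrrN opprB; move: (dist t t0).
  by have := sqr_ge0 (complex.Im (F t) - complex.Im (F t0)); lra.
- move=> close; rewrite -[ltLHS]sqrrN opprB; move: (dist t t0).
  by have := sqr_ge0 (complex.Re (F t) - complex.Re (F t0)); lra.
Unshelve. all: end_near. Qed.

(** A change of sign would force a zero. *)
Lemma continuous_sqr_cst (f : R -> R) (c : R) : continuous f -> 0 < c ->
  (forall t, f t ^+ 2 = c) -> forall s t, f s = f t.
Proof.
move=> cf c0 fc; suff le s t : s <= t -> f s = f t.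
  by move=> s t; have [/le|/ltW/le] := leP s t.
move=> st; have /eqP : f s ^+ 2 = f t ^+ 2 by rewrite !fc.
rewrite eqf_sqr => /orP[/eqP//|/eqP ft].
have cw : {within `[s, t], continuous f} by apply: continuous_subspaceT.
have [|x _ fx] := @IVT _ f s t 0 st cw.
  rewrite ft ge_min le_max.
  by rewrite oppr_le0 oppr_ge0; have [_|/ltW ->] := leP (f t) 0; rewrite ?orbT.
by move: c0; rewrite -(fc x) fx expr0n ltxx.
Qed.

(** The smallest point of [0, b] at which D takes the value D v exists by
    compactness, and phi would decrease it further unless it is 0. *)
Lemma descent (D : R -> R[i]) (phi : R -> R) (b : R) : ccontinuous D ->
  (forall v, 0 < v <= b -> 0 <= phi v < v /\ D (phi v) = D v) ->
  forall v, 0 <= v <= b -> D v = D 0.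
Proof.
move=> [cR cI] Dphi v hv.
pose S := (`[0, b]%classic `&` [set x | complex.Re (D x) = complex.Re (D v)])
  `&` [set x | complex.Im (D x) = complex.Im (D v)].
have cS : compact S.
  apply: compact_closedI; first apply: compact_closedI.
  - exact: segment_compact.
  - apply: (@preimage_closed _ _ (fun x => complex.Re (D x)) [set complex.Re (D v)]).
      by move=> x _; exact: cR.
    exact: closed_eq.
  - apply: (@preimage_closed _ _ (fun x => complex.Im (D x)) [set complex.Im (D v)]).
      by move=> x _; exact: cI.
    exact: closed_eq.
have [||c] := @compact_EVT_min _ _ (fun x : R => x) S _ cS.
- by exists v; do !split => //=; rewrite in_itv.
- by apply: continuous_subspaceT => x; exact: cvg_id.
rewrite inE => -[[/=]]; rewrite in_itv/= => /andP[c0 cb] DRc DIc cmin.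
have Dc : D c = D v.
  by move: DRc DIc; case: (D c) (D v) => ? ? [? ?] /= -> ->.
have [c_gt0|] := ltP 0 c; last first.
  by move=> c_le0; rewrite -Dc; congr D; apply/eqP; rewrite eq_le c0 c_le0.
have [|/andP[p0 pc] Dp] := Dphi c; first by rewrite c_gt0.
have : phi c \in S.
  rewrite inE; do !split; rewrite /= ?Dp ?Dc// in_itv/= p0.
  exact: le_trans (ltW pc) cb.
by move/cmin; rewrite leNgt pc.
Qed.

End Descent.

(** * Multiplicativity of the induced map *)

Section Multiplicativity.
Variable R : realType.
Implicit Types (A B P Q : R[i]) (k : R) (g h : R[i] -> R[i]).

(** The curve u = u(v) given by cos u = k cos v satisfies u = th at v = 0
    and u < v + th for 0 < v <= pi/2, where th = acos k.  So
    D(v) = H(v + th) has D(u(v) - th) = D(v) with u(v) - th < v, and the descent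
    makes D constant on [0, pi/2].  The two symmetries of H extend
    this to an interval of length pi that contains [0, pi/2] after the
    shift by th. *)
Lemma chord_mean_constant k (H : R -> R[i]) : 0 < k < 1 -> ccontinuous H ->
  (forall u, H (- u) = H u) ->
  (forall v, H (v + acos k) = H (v - acos k)) ->
  (forall u v, cos u = k * cos v -> H u = H (v + acos k)) ->
  forall u, - (pi / 2) <= u <= pi / 2 -> H u = H 0.
Proof.
move=> /andP[k0 k1] cH even shift step; set th : R := acos k in shift step *.
have k11 : -1 <= k <= 1 by lra.
have cth : cos th = k by apply: acosK; rewrite in_itv/=; lra.
have th0 : 0 < th by apply: acos_gt0; lra.
have cos_lt (x y : R) : 0 <= x <= pi -> 0 <= y <= pi -> (cos x < cos y) = (y < x).
  by move=> hx hy; rewrite ltr_cos// in_itv.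
have pi0 := @pi_gt0 R.
have thp : th < pi / 2.
  by rewrite -cos_lt; [|lra|rewrite acos_ge0 ?acos_lepi//; lra];
     rewrite cos_pihalf cth.
pose D v := H (v + th).
have Deven v : D (- v) = D v.
  by rewrite /D shift -even opprD opprK addrC; congr H; ring.
have Dpos : forall v, 0 <= v <= pi / 2 -> D v = D 0.
  apply: (@descent _ D (fun v => acos (k * cos v) - th)).
    apply: (ccontinuous_comp (u := fun v => v + th)) => // x.
    by apply: cvgD; [exact: cvg_id|exact: cvg_cst].
  move=> v /andP[v0 v2].
  have cv0 : 0 <= cos v by apply: cos_ge0_pihalf; lra.
  have sv0 : 0 < sin v by apply: sin_gt0_pi; lra.
  have sth : 0 < sin th by apply: sin_gt0_pi; lra.
  have cv1 := cos_le1 v.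
  have kc : 0 <= k * cos v <= k by nra.
  have a0 : 0 <= acos (k * cos v) <= pi by rewrite acos_ge0 ?acos_lepi//; lra.
  have ca : cos (acos (k * cos v)) = k * cos v.
    by apply: acosK; rewrite in_itv/=; lra.
  split; last by rewrite /D subrK; apply: step.
  apply/andP; split.
    by rewrite subr_ge0 leNgt -cos_lt ?ca ?cth; [rewrite -leNgt; lra|lra|lra].
  by rewrite ltrBlDr -cos_lt ?ca ?cosD ?cth; [nra|lra|lra].
have Dall v : - (pi / 2) <= v <= pi / 2 -> D v = D 0.
  move=> hv; have [v0|v0] := leP 0 v; first by apply: Dpos; lra.
  by rewrite -Deven; apply: Dpos; lra.
have Hpos u : 0 <= u <= pi / 2 -> H u = D 0.
  by move=> hu; rewrite -[u](subrK th); apply: Dall; lra.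
move=> u hu; rewrite (Hpos 0); last by lra.
have [u0|u0] := leP 0 u; first by apply: Hpos; lra.
by rewrite -even; apply: Hpos; lra.
Qed.

(** For a secant the two inner points have distinct images, which are then the
    two points of the image chord on its inner circle.  For a tangent chord
    the image is tangent too: a second inner point of the image chord would come
    from a second inner point of the chord. *)
Lemma iso_product k k' g h : circle_pair_iso k k' g h ->
  forall A B P, unitc A -> unitc B -> unitc P -> chord k A B P ->
  g A * g B = h P * h (A * B / P).
Proof.
move=> [/andP[k0 _] /andP[k'0 _] uG uH _ _ iH sH cG] A B P uA uB uP H1.
have uQ : unitc (A * B / P) by apply: unitc_div => //; exact: unitc_mul.
have nz := unitc_neq0.
have H2 := chord_other (nz _ _ uA) (nz _ _ uB) (nz _ _ uP) H1.
have H1' := (cG _ _ _ uA uB uP).1 H1.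
have H2' := (cG _ _ _ uA uB uQ).1 H2.
have [PQ|PQ] := eqVneq P (A * B / P); last first.
  apply: (chord_pair (lt0r_neq0 k'0) (nz _ _ (uH _ uP)) (nz _ _ (uH _ uQ)) _ H1' H2').
  by apply/eqP => /iH E; case/eqP: PQ; exact: E.
rewrite -PQ; have uQ' : unitc (g A * g B / h P).
  by apply: unitc_div; [apply: unitc_mul; exact: uG | exact: uH].
have H3' := chord_other (nz _ _ (uG _ uA)) (nz _ _ (uG _ uB)) (nz _ _ (uH _ uP)) H1'.
have [Q uQQ EQ] := sH _ uQ'; rewrite -EQ in H3'.
have H3 := (cG _ _ _ uA uB uQQ).2 H3'.
have [PQQ|PQQ] := eqVneq P Q.
  by rewrite -PQQ in EQ; rewrite {2}EQ [RHS]mulrC divfK// nz//; exact: uH.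
have := chord_pair (lt0r_neq0 k0) (nz _ _ uP) (nz _ _ uQQ) PQQ H1 H3.
move=> E; case/eqP: PQQ; rewrite {1}PQ E; field.
exact: nz.
Qed.

Lemma iso_cis_product k k' g h : circle_pair_iso k k' g h ->
  forall m u v, cos u = k * cos v ->
  g (cis (m + u)) * g (cis (m - u)) = h (cis (m + v)) * h (cis (m - v)).
Proof.
move=> iso m u v uv.
rewrite (iso_product iso (unitc_cis _) (unitc_cis _) (unitc_cis _)
  ((chord_cis k m u v).2 uv)).
congr (_ * h _); rewrite -cisD -cisB; congr cis; ring.
Qed.

Lemma iso_continuous k k' g h : circle_pair_iso k k' g h ->
  ccontinuous (fun t => g (cis t)).
Proof.
move=> iso; apply: close_ccontinuous; last exact: iso_close iso.
by move=> t; apply/(iso_outer iso)/unitc_cis.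
Qed.

(** The outer points m + th and m - th span the chord tangent at m.  Its image
    is tangent at h(m), so the quotient q(m) of the images has the fixed real part
    2 k'^2 - 1, which leaves two values with opposite imaginary parts;
    continuity makes q constant. *)
Lemma iso_rotation k k' g h : circle_pair_iso k k' g h ->
  exists q w : R[i], w ^+ 2 = q /\ forall m,
    g (cis (m + acos k)) = q * g (cis (m - acos k)) /\
    h (cis m) = w * g (cis (m - acos k)).
Proof.
move=> iso; have [/andP[k0 k1] /andP[k'0 k'1] uG uH _ _ _ _ cG] := iso.
set th := acos k.
have cth : cos th = k by apply: acosK; rewrite in_itv/=; lra.
have cth0 : cos th = k * cos 0 by rewrite cos0 mulr1.
have ux t : unitc (g (cis t)) by apply/uG/unitc_cis.
have nz t : g (cis t) != 0 by exact: unitc_neq0.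
have hz t : h (cis t) != 0 by apply/unitc_neq0/uH/unitc_cis.
have prod m : g (cis (m + th)) * g (cis (m - th)) = h (cis m) ^+ 2.
  by rewrite (iso_cis_product iso m cth0) addr0 subr0 expr2.
have sum m : g (cis (m + th)) + g (cis (m - th)) = k'%:C * (h (cis m) + h (cis m)).
  have : chord k (cis (m + th)) (cis (m - th)) (cis (m + 0)).
    exact/chord_cis.
  move/(cG _ _ _ (unitc_cis _) (unitc_cis _) (unitc_cis _)).
  by rewrite /chord prod addr0 expr2 mulfK.
pose q m := g (cis (m + th)) / g (cis (m - th)).
have uq m : unitc (q m) by exact: unitc_div.
have qRe m : complex.Re (q m) = 2 * k' ^+ 2 - 1.
  have : q m + (q m)^-1 = (4 * k' ^+ 2 - 2)%:C.
    transitivity ((g (cis (m + th)) + g (cis (m - th))) ^+ 2 /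
      (g (cis (m + th)) * g (cis (m - th))) - (1 + 1)).
      by rewrite /q; field; rewrite !nz.
    rewrite prod sum.
    transitivity (k'%:C * k'%:C * (1 + 1 + 1 + 1) - (1 + 1)); first by field.
    by simpc; congr (_ +i* _); ring.
  rewrite (unitcV (uq m)) /cconj; case: (q m) => a b; simpc => -[] /=; lra.
have qIm m : complex.Im (q m) ^+ 2 = 1 - (2 * k' ^+ 2 - 1) ^+ 2.
  by have := uq m; rewrite /unitc qRe; lra.
have qc : ccontinuous q.
  have cG0 := iso_continuous iso.
  apply: ccontinuousM.
    apply: (ccontinuous_comp cG0 (u := fun m => m + th)) => x.
    by apply: cvgD; [exact: cvg_id|exact: cvg_cst].
  apply: ccontinuousV => //.
  apply: (ccontinuous_comp cG0 (u := fun m => m - th)) => x.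
  by apply: cvgB; [exact: cvg_id|exact: cvg_cst].
have qE m : q m = q 0.
  have : complex.Im (q m) = complex.Im (q 0).
    apply: (continuous_sqr_cst qc.2 _ qIm).
    by have : k' ^+ 2 < 1 by [nra]; have : 0 < k' ^+ 2 by [nra]; nra.
  by move: (qRe m) (qRe 0); case: (q m) (q 0) => a b [c d] /= -> -> ->.
have rot m : g (cis (m + th)) = q 0 * g (cis (m - th)).
  by rewrite -(qE m) /q divfK.
have k'C : k'%:C != 0 by rewrite realc_eq0 gt_eqF.
have hE m : h (cis m) = (1 + q 0) / (k'%:C * (1 + 1)) * g (cis (m - th)).
  have := sum m; rewrite rot => E.
  have two : (1 + 1 : R[i]) != 0 by rewrite (_ : 1 + 1 = 2%:C) ?realc_eq0//; simpc.
  apply: (mulfI (mulf_neq0 k'C two));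
  transitivity (k'%:C * (h (cis m) + h (cis m))); first by ring.
  by rewrite -E; field; rewrite k'C ?two.
exists (q 0), ((1 + q 0) / (k'%:C * (1 + 1)));
  split; last by split; [exact: rot|exact: hE].
have := prod 0; rewrite (hE 0) rot exprMn -mulrA -expr2.
by move/(mulIf (expf_neq0 2 (nz _))).
Qed.

(** Here H(u) = g(m + u) g(m - u), and [iso_rotation] rewrites the inner
    product h(m + v) h(m - v) as H(v + th). *)
Lemma iso_mean_local k k' g h : circle_pair_iso k k' g h ->
  forall m u, - (pi / 2) <= u <= pi / 2 ->
  g (cis (m + u)) * g (cis (m - u)) = g (cis m) ^+ 2.
Proof.
move=> iso m; have [q [w [wq rot]]] := iso_rotation iso.
have cG0 := iso_continuous iso.
have ux t : unitc (g (cis t)) by apply/(iso_outer iso)/unitc_cis.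
have q0 : q != 0.
  apply: contraTneq isT => q0; have [+ _] := rot 0.
  by rewrite q0 mul0r => /eqP; rewrite (negbTE (unitc_neq0 (ux _))).
pose H u := g (cis (m + u)) * g (cis (m - u)).
have shift v : H (v + acos k) = H (v - acos k).
  rewrite /H (_ : m + (v + _) = m + v + acos k); last by ring.
  rewrite (_ : m - (v - _) = m - v + acos k); last by ring.
  rewrite (_ : m - (v + _) = m - v - acos k); last by ring.
  rewrite (_ : m + (v - _) = m + v - acos k); last by ring.
  by rewrite (rot (m + v)).1 (rot (m - v)).1 mulrCA mulrA.
move=> u hu; transitivity (H 0); last by rewrite /H subr0 addr0 expr2.
apply: (chord_mean_constant (iso_ratio iso)) hu => //.
- apply: ccontinuousM; apply: (ccontinuous_comp cG0 (u := fun x => _ + _)) => x;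
    apply: cvgD; try exact: cvg_cst; try exact: cvg_id.
  by apply: cvgN; exact: cvg_id.
- by move=> v; rewrite /H opprK mulrC.
- move=> x v xv; rewrite {1}/H (iso_cis_product iso m xv).
  rewrite (rot (m + v)).2 (rot (m - v)).2 mulrACA -expr2 wq shift /H.
  rewrite (_ : m - (v - _) = m - v + acos k); last by ring.
  by rewrite (rot (m - v)).1 mulrCA !mulrA addrA.
Qed.

(** Replacing m by m + pi, and so u by u - pi, leaves the two factors
    unchanged up to full turns, and g(m + pi)^2 = g(m)^2 by the local case at u = pi/2. *)
Lemma iso_mean k k' g h : circle_pair_iso k k' g h ->
  forall m u, g (cis (m + u)) * g (cis (m - u)) = g (cis m) ^+ 2.
Proof.
move=> iso m u; have pi0 := @pi_gt0 R.
have [n hn] : exists n : nat, `|u| <= pi / 2 + pi *+ n.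
  have := archi_boundP (divr_ge0 (normr_ge0 u) (ltW pi0)).
  set n := Num.bound _ => un; exists n; rewrite ltr_pdivrMr// in un.
  by rewrite -mulr_natl; lra.
elim: n m u hn => [|n IH] m u hn.
  by apply: (iso_mean_local iso); rewrite -ler_norml; move: hn; rewrite mulr0n addr0.
wlog u0 : u hn / 0 <= u.
  move=> W; have [/W|u0] := leP 0 u; first exact.
  by have := W (- u); rewrite normrN opprK [g _ * _]mulrC; apply => //; lra.
have [u2|u2] := leP u (pi / 2); first by apply: (iso_mean_local iso); lra.
have turn (t : R) : cis (t + pi) = cis (t - pi).
  by rewrite cisB cisD cispi invrN1.
have small : `|u - pi| <= pi / 2 + pi *+ n.
  move: hn; rewrite [pi *+ _]mulrS (ger0_norm u0) => hn.
  have := mulrn_wge0 n (ltW pi0); rewrite ler_norml.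
  by move: (pi *+ n) hn => x hn x0; lra.
have square : g (cis (m + pi)) ^+ 2 = g (cis m) ^+ 2.
  rewrite -(iso_mean_local iso (m + pi) (u := pi / 2)); last by lra.
  rewrite -(iso_mean_local iso m (u := pi / 2)); last by lra.
  rewrite mulrC; congr (g _ * g _).
    by congr cis; field.
  by rewrite (_ : m + _ + _ = m + pi / 2 + pi) ?turn; [congr cis; field|field].
rewrite -square -(IH (m + pi) (u - pi) small); congr (g _ * g _).
  by congr cis; ring.
by rewrite (_ : m + pi - _ = m - u + pi + pi) ?turn; [congr cis; ring|ring].
Qed.

(** Both sides are the square of g at the half-angle (x + y) / 2. *)
Lemma iso_multiplicative k k' g h : circle_pair_iso k k' g h ->
  forall x y, g (cis (x + y)) * g 1 = g (cis x) * g (cis y).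
Proof.
move=> iso x y; rewrite -(cis0 R).
transitivity (g (cis ((x + y) / 2)) ^+ 2).
  by rewrite -(iso_mean iso ((x + y) / 2) ((x + y) / 2)) subrr;
    congr (g (cis _) * _); field.
by rewrite -(iso_mean iso ((x + y) / 2) ((x - y) / 2));
  congr (g (cis _) * g (cis _)); field.
Qed.

End Multiplicativity.

(** * Continuous injective endomorphisms of the circle *)

Section CircleMorphism.
Variable R : realType.

(** Injectivity confines F(t), for t in (0, pi), to the open upper half circle,
    since F(t) = 1 or -1 would give F(2 t) = 1.  This fixes the
    choice of square roots when angles are halved, so F and cis agree at
    pi / 2^n, then on the dense group generated by these angles. *)
Lemma circle_morphism_cis (F : R -> R[i]) : (forall t, unitc (F t)) ->
  ccontinuous F -> (forall x y, F (x + y) = F x * F y) ->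
  (forall t, F t = 1 <-> cis t = 1) ->
  0 < complex.Im (F (pi / 2)) -> forall t, F t = cis t.
Proof.
move=> uF cF FD F1 pos; have [cR cI] := cF.
have pi0 := @pi_gt0 R.
have cis1 (t : R) : cis t = 1 -> sin (t / 2) = 0.
  rewrite -{1}[t](_ : t / 2 + t / 2 = t); last by field.
  move=> H; have := Re_cis_double (t / 2); rewrite H /= cos2sin2.
  by move=> E; apply/eqP; rewrite -sqrf_eq0; apply/eqP; lra.
have F0 : F 0 = 1 by apply/F1; exact: cis0.
have Fpi : F pi = -1.
  have : F pi ^+ 2 = 1 by rewrite expr2 -FD; apply/F1; exact: cis2pi.
  move/eqP; rewrite sqrf_eq1 => /orP[/eqP/F1|/eqP//].
  by move/cis1; rewrite sin_pihalf => /eqP; rewrite oner_eq0.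
have Fi : F (pi / 2) = 0 +i* 1.
  have : F (pi / 2) ^+ 2 = -1 by rewrite expr2 -FD -Fpi; congr F; field.
  move: pos; case: (F (pi / 2)) => a b /= b0; rewrite expr2; simpc => -[H1 H2].
  have a0 : a = 0 by nra.
  by congr (_ +i* _) => //; rewrite a0 in H1; nra.
(* By the intermediate value theorem between t and pi/2, a sign change
   would produce s in (0, pi) with F(s) = 1 or -1. *)
have Fpos t : 0 < t < pi -> 0 < complex.Im (F t).
  move=> ht; rewrite ltNge; apply/negP => le0.
  have [s hs] : exists2 s, 0 < s < pi & complex.Im (F s) = 0.
    have W (a b : R) : a <= b -> 0 < a -> b < pi ->
        Num.min (complex.Im (F a)) (complex.Im (F b)) <= 0
          <= Num.max (complex.Im (F a)) (complex.Im (F b)) ->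
        exists2 s, 0 < s < pi & complex.Im (F s) = 0.
      move=> ab a0 bp H.
      have [||s] := @IVT R (fun t => complex.Im (F t)) a b 0 ab => //.
        exact: continuous_subspaceT.
      by rewrite in_itv/= => hs Fs; exists s => //; lra.
    have [l|l] := leP t (pi / 2).
      by apply: (W _ _ l); rewrite ?ge_min ?le_max ?le0 ?(ltW pos) ?orbT//; lra.
    by apply: (W _ _ (ltW l)); rewrite ?ge_min ?le_max ?le0 ?(ltW pos) ?orbT//; lra.
  move=> Fs; have : F (s + s) = 1.
    have := uF s; rewrite /unitc FD; move: Fs; case: (F s) => a b /= ->.
    by simpc; rewrite -!expr2 expr0n addr0 => ->.
  move/F1/cis1; rewrite (_ : (s + s) / 2 = s); last by field.
  by have := sin_gt0_pi hs; lra.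
have Fre t : - (pi / 2) < t < pi / 2 -> 0 < complex.Re (F t).
  move=> ht; have : 0 < complex.Im (F (t + pi / 2)) by apply: Fpos; lra.
  by rewrite FD Fi; case: (F t) => a b /=; rewrite mulr0 mulr1 addr0.
pose s n : R := pi / 2 / 2 ^+ n.
have sS n : s n = s n.+1 + s n.+1.
  by rewrite /s exprS; field; rewrite expf_neq0.
have s0 n : 0 < s n by rewrite !divr_gt0// exprn_gt0.
have s_le n : s n <= pi / 2.
  by rewrite /s ler_pdivrMr ?exprn_gt0// ler_peMr ?exprn_ege1//; lra.
have Fs n : F (s n) = cis (s n).
  elim: n => [|n IH].
    by rewrite /s expr0 divr1 Fi /cis cos_pihalf sin_pihalf.
  have : F (s n.+1) ^+ 2 = cis (s n.+1) ^+ 2 by rewrite !expr2 -FD -cisD -sS.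
  have h : - (pi / 2) < s n.+1 < pi / 2.
    by have := s0 n.+1; have := s_le n; rewrite sS; lra.
  move/eqP; rewrite eqf_sqr => /orP[/eqP//|/eqP E].
  have := Fre _ h; rewrite E /cis /= oppr_gt0.
  by move/lt_trans => /(_ _ (cos_gt0_pihalf h)); rewrite ltxx.
pose E t := F t / cis t.
have ED x y : E (x + y) = E x * E y.
  by rewrite /E FD cisD; field; rewrite !cis_neq0.
have Esm n m : E (s n *+ m) = 1.
  elim: m => [|m IH]; first by rewrite mulr0n /E F0 cis0 divr1.
  by rewrite mulrS ED IH mulr1 /E Fs divff// cis_neq0.
have uE t : unitc (E t) by apply: unitc_div => //; exact: unitc_cis.
have cE : ccontinuous E.
  apply: ccontinuousM => //; apply: ccontinuousV; last exact: ccontinuous_cis.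
  exact: unitc_cis.
have E1 t : 0 <= t -> E t = 1.
  move=> t0; suff Re1 : complex.Re (E t) = 1.
    have := uE t; rewrite /unitc; move: Re1; case: (E t) => a b /= ->.
    by move=> H; congr (_ +i* _); apply/eqP; rewrite -sqrf_eq0; apply/eqP; lra.
  apply/eqP; rewrite -subr_eq0 -normr_eq0 eq_le normr_ge0 andbT.
  apply/ler_addgt0Pr => e e0; rewrite add0r.
  have : \forall x \near (0 : R), `|complex.Re (E 0) - complex.Re (E x)| < e.
    by have := cE.1 (0 : R); move/cvgrPdist_lt; apply.
  move=> /nbhs_ballP[d /= d0 near0].
  have [n sn] : exists n, s n < d.
    exists (Num.bound (pi / 2 / d)); set n := Num.bound _.
    rewrite /s ltr_pdivrMr ?exprn_gt0// [d * _]mulrC -ltr_pdivrMr//.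
    have pd : 0 <= pi / 2 / d by rewrite ltW// !divr_gt0.
    apply: lt_trans (archi_boundP pd) _.
    by rewrite -natrX ltr_nat; exact: ltn_expl.
  have /andP[m1 m2] := truncn_itv (divr_ge0 t0 (ltW (s0 n))).
  set m := Num.truncn _ in m1 m2.
  rewrite ler_pdivlMr// in m1; rewrite ltr_pdivrMr// in m2.
  have -> : E t = E (t - s n *+ m).
    by rewrite -{1}[t](subrK (s n *+ m)) ED Esm mulr1.
  have -> : 1 = complex.Re (E 0) by rewrite /E F0 cis0 divr1.
  rewrite distrC; apply/ltW/near0; rewrite /ball/= sub0r normrN.
  rewrite -mulr_natl; rewrite -natr1 mulrDl mul1r in m2.
  by rewrite ger0_norm; lra.
move=> t; suff : E t = 1 by move/divr1_eq.
have [t0|t0] := leP 0 t; first exact: E1.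
have := ED t (- t); rewrite subrr (E1 (- t)) ?mulr1; last by lra.
by rewrite (E1 0).
Qed.

End CircleMorphism.

(** * Rigidity on the unit circle *)

Section Rigidity.
Variable R : realType.
Implicit Types (A B P Q : R[i]) (k : R) (g h : R[i] -> R[i]).

(** Since F(pi) = -1, the value F(pi/2) is i or -i; the second case is reduced to
    the first by passing to the inverse of F. *)
Lemma circle_morphism (F : R -> R[i]) : (forall t, unitc (F t)) ->
  ccontinuous F -> (forall x y, F (x + y) = F x * F y) ->
  (forall t, F t = 1 <-> cis t = 1) ->
  exists2 s : R, s ^+ 2 = 1 & forall t, F t = cis (s * t).
Proof.
move=> uF cF FD F1.
have [pos|neg|im0] := ltgtP 0 (complex.Im (F (pi / 2))).
- by exists 1 => [|t]; rewrite ?expr1n// mul1r (circle_morphism_cis uF).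
- exists (-1) => [|t]; first by rewrite sqrrN expr1n.
  rewrite mulN1r cisN -(@circle_morphism_cis _ (fun t => (F t)^-1)) ?invrK//.
  + by move=> x; apply: unitc_inv.
  + exact: ccontinuousV.
  + by move=> x y; rewrite FD invfM.
  + move=> x; split=> [/(congr1 (@GRing.inv R[i]))|/F1 ->]; rewrite ?invr1//.
    by rewrite invrK => /F1.
  + by rewrite unitc_ImV// oppr_gt0.
- have /F1 : F pi = 1.
    rewrite (_ : pi = pi / 2 + pi / 2) ?FD; last by field.
    have := uF (pi / 2); rewrite /unitc; move: im0; case: (F _) => a b /= <-.
    by simpc; rewrite -!expr2 expr0n addr0 => ->.
  by rewrite cispi => -[]; lra.
Qed.

(** Once g is known, the tangent chord at t gives
    k g(t) = k' h(t), and the moduli of both sides yield k = k'. *)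
Lemma iso_rigid k k' g h : circle_pair_iso k k' g h ->
  k = k' /\ exists (w : R[i]) (s : R), [/\ unitc w, s ^+ 2 = 1 &
    forall t, g (cis t) = w * cis (s * t) /\ h (cis t) = w * cis (s * t)].
Proof.
move=> iso; have [/andP[k0 k1] /andP[k'0 k'1] uG uH iG _ _ _ cG] := iso.
have u1 : unitc (1 : R[i]) by rewrite -(cis0 R); exact: unitc_cis.
pose w := g 1; have uw : unitc w by exact: uG.
have w0 := unitc_neq0 uw.
have [|||t|s s1 gE] := @circle_morphism (fun t => g (cis t) / w).
- by move=> t; apply: unitc_div => //; apply/uG/unitc_cis.
- apply: ccontinuousM; first exact: iso_continuous iso.
  exact: ccontinuous_cst.
- move=> x y; apply: (mulIf w0); rewrite divfK//.
  apply: (mulIf w0); rewrite (iso_multiplicative iso).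
  by field.
- split=> [/divr1_eq|->]; last by rewrite divff.
  by apply: iG => //; exact: unitc_cis.
have {}gE t : g (cis t) = w * cis (s * t) by rewrite -gE mulrC divfK.
have cosE t : cos (s * t) = cos t.
  move/eqP: s1; rewrite sqrf_eq1 => /orP[] /eqP ->; first by rewrite mul1r.
  by rewrite mulN1r cosN.
pose th := acos k; have cth : cos th = k by apply: acosK; rewrite in_itv/=; lra.
have hE t : k%:C * (w * cis (s * t)) = k'%:C * h (cis t).
  have cth0 : cos th = k * cos 0 by rewrite cos0 mulr1.
  have := (chord_cis k t th 0).2 cth0.
  move/(cG _ _ _ (unitc_cis _) (unitc_cis _) (unitc_cis _)).
  rewrite /chord (iso_cis_product iso t cth0) addr0 subr0 mulfK; last first.
    by apply/unitc_neq0/uH/unitc_cis.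
  rewrite !gE mulrDr mulrBr cisB cisD -!mulrDr cis_cos cosE cth.
  rewrite realcM => E.
  have two : 2%:C != 0 :> R[i] by rewrite realc_eq0.
  apply: (mulfI two); transitivity (w * (cis (s * t) * (2%:C * k%:C))); first by ring.
  by rewrite E (_ : 2%:C = 1 + 1); [ring|simpc].
have kk : k = k'.
  have := hE 0; rewrite mulr0 cis0 mulr1.
  have := uH _ u1; have := uw; rewrite /unitc.
  case: w {uw w0 gE hE} (h 1) => a b [c d] /= ab cd; simpc => -[e1 e2].
  have : k ^+ 2 = k' ^+ 2.
    rewrite -[LHS]mulr1 -ab -[RHS]mulr1 -cd mulrDr mulrDr -!exprMn e1 e2.
    by [].
  by move/eqP; rewrite eqf_sqr => /orP[/eqP//|/eqP]; lra.
split=> //; exists w, s; split=> // t; split=> //.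
apply: (mulfI (x := k%:C)); first by rewrite realc_eq0 gt_eqF.
by rewrite hE kk.
Qed.

End Rigidity.

(** * From the plane to the unit circle *)

Section Plane.
Variable R : realType.
Implicit Types (p x y : 'rV[R]_2) (c : 'rV[R]_2) (z w : R[i]) (rho : R).

Definition toC p : R[i] := p 0 0 +i* p 0 1.
Definition ofC z : 'rV[R]_2 :=
  \row_j (if j == 0 then complex.Re z else complex.Im z).

Definition normsq z : R := complex.Re z ^+ 2 + complex.Im z ^+ 2.

Lemma row2P x y : x 0 0 = y 0 0 -> x 0 1 = y 0 1 -> x = y.
Proof.
move=> xy0 xy1; apply/rowP => -[[|[|//]] hj].
  by rewrite (_ : Ordinal hj = 0) //; apply: val_inj.
by rewrite (_ : Ordinal hj = 1) //; apply: val_inj.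
Qed.

Lemma toCK : cancel toC ofC.
Proof. by move=> p; apply: row2P; rewrite !mxE. Qed.

Lemma ofCK : cancel ofC toC.
Proof. by case=> a b; rewrite /toC !mxE. Qed.

Lemma ofCD z w : ofC (z + w) = ofC z + ofC w.
Proof. by case: z w => a b [d e]; apply: row2P; rewrite !mxE. Qed.

Lemma ofCB z w : ofC (z - w) = ofC z - ofC w.
Proof. by case: z w => a b [d e]; apply: row2P; rewrite !mxE. Qed.

Lemma ofCZ (a : R) z : ofC (a%:C * z) = a *: ofC z.
Proof. by case: z => d e; simpc; apply: row2P; rewrite !mxE. Qed.

Lemma toCB x y : toC (x - y) = toC x - toC y.
Proof. by rewrite /toC !mxE; simpc. Qed.

Lemma normsq_ge0 z : 0 <= normsq z.
Proof. by rewrite addr_ge0 ?sqr_ge0. Qed.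

Lemma normsqM z w : normsq (z * w) = normsq z * normsq w.
Proof. by case: z w => a b [d e]; rewrite /normsq /=; ring. Qed.

Lemma normsq_real (a : R) : normsq a%:C = a ^+ 2.
Proof. by rewrite /normsq /= expr0n addr0. Qed.

Lemma enorm_ofC z : enorm (ofC z) = Num.sqrt (normsq z).
Proof. by rewrite /enorm big_ord_recl big_ord_recl big_ord0 addr0 !mxE. Qed.

Definition polar c rho z : 'rV[R]_2 := c + ofC (rho%:C * z).

Lemma polar_inj c rho z w : rho != 0 -> polar c rho z = polar c rho w -> z = w.
Proof.
move=> rho0 /addrI /(can_inj ofCK) /mulfI; apply.
by rewrite realc_eq0.
Qed.

Lemma unitcN z : unitc z -> unitc (- z).
Proof. by rewrite /unitc; case: z => a b /=; rewrite !sqrrN. Qed.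

Lemma polar_radius c a b z w : 0 <= a -> 0 <= b -> unitc z -> unitc w ->
  polar c a z = polar c b w -> a = b.
Proof.
move=> a0 b0 uz uw /addrI /(can_inj ofCK) /(congr1 normsq).
rewrite !normsqM !normsq_real [normsq z]uz [normsq w]uw !mulr1 => /eqP.
by rewrite eqrXn2// => /eqP.
Qed.

Lemma circleP c rho p : 0 < rho ->
  circle c rho p <-> exists2 z, unitc z & p = polar c rho z.
Proof.
move=> rho0; have rhoC : rho%:C != 0 by rewrite realc_eq0 gt_eqF.
rewrite /circle /= -[p - c]toCK enorm_ofC; split=> [e|[z uz ->]].
  have e2 : normsq (toC (p - c)) = rho ^+ 2.
    by rewrite -e sqr_sqrtr// normsq_ge0.
  exists (toC (p - c) / rho%:C).
    have : normsq (toC (p - c) / rho%:C) * rho ^+ 2 = rho ^+ 2.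
      by rewrite -normsq_real -normsqM divfK// normsq_real.
    rewrite -[RHS]mul1r => /mulIf; apply.
    by rewrite expf_neq0// gt_eqF.
  by rewrite /polar mulrC divfK// toCK addrC subrK.
rewrite /polar addrC addKr ofCK normsqM normsq_real.
by rewrite [normsq z]uz mulr1 sqrtr_sqr gtr0_norm.
Qed.

Lemma segment_polar c rho1 rho2 rho3 A B P :
  segment (polar c rho1 A) (polar c rho2 B) (polar c rho3 P) <->
  exists2 l : R, 0 <= l <= 1 &
    rho3%:C * P = l%:C * (rho1%:C * A) + (1 - l)%:C * (rho2%:C * B).
Proof.
rewrite /segment /polar; split=> [[l /= hl E]|[l hl ->]]; exists l => //.
  apply: (can_inj ofCK); rewrite ofCD !(ofCZ l) !(ofCZ (1 - l)).
  by apply: (addrI c); rewrite -E; apply: row2P; rewrite !mxE; ring.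
by rewrite ofCD !(ofCZ l) !(ofCZ (1 - l)); apply: row2P; rewrite !mxE; ring.
Qed.

Lemma segment_chord c r r' A B P : 0 < r < r' ->
  unitc A -> unitc B -> unitc P ->
  segment (polar c r' A) (polar c r' B) (polar c r P) <-> chord (r / r') A B P.
Proof.
move=> /andP[r0 rr'] uA uB uP; have r'0 : 0 < r' by exact: lt_trans rr'.
have r'C : r'%:C != 0 by rewrite realc_eq0 gt_eqF.
have rE : r%:C = r'%:C * (r / r')%:C.
  by rewrite -realcM mulrC divfK// gt_eqF.
rewrite segment_polar chord_segment//; last by rewrite divr_gt0// ltr_pdivrMr ?mul1r.
split=> -[l hl E]; exists l => //.
  apply: (mulfI r'C); rewrite mulrA -rE E; ring.
by rewrite rE -mulrA E; ring.
Qed.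

Definition extreme (S : set 'rV[R]_2) x :=
  forall u v, S u -> S v -> segment u v x -> x = u \/ x = v.

Lemma extreme_iso S T f x : betweenness_isomorphism S T f -> S x ->
  extreme S x <-> extreme T (f x).
Proof.
move=> [[fS fi fs] fb] Sx; split=> ex u v.
  move=> /fs[y Sy <-] /fs[z Sz <-] /(fb _ _ _ Sx Sy Sz) /(ex _ _ Sy Sz).
  by case=> ->; [left|right].
move=> Su Sv /(fb _ _ _ Sx Su Sv) /(ex _ _ (fS _ Su) (fS _ Sv)).
by case=> /fi E; [left|right]; apply: E; rewrite inE.
Qed.

Lemma normsq_convex (l : R) z w : normsq (l%:C * z + (1 - l)%:C * w) =
  l * normsq z + (1 - l) * normsq w - l * (1 - l) * normsq (z - w).
Proof. by case: z w => a b [d e]; rewrite /normsq /=; ring. Qed.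

Lemma normsq_eq0 z : normsq z = 0 -> z = 0.
Proof.
case: z => a b; rewrite /normsq /= => ab.
have := sqr_ge0 a; have := sqr_ge0 b => b0 a0.
by congr (_ +i* _); apply/eqP; rewrite -sqrf_eq0; apply/eqP; lra.
Qed.

(** An outer point is at maximal norm in the pair, and the norm is strictly
    convex; an inner point lies inside the outer diameter through it. *)
Lemma extreme_outer c r r' x : 0 < r < r' ->
  (circle c r `|` circle c r') x ->
  circle c r' x <-> extreme (circle c r `|` circle c r') x.
Proof.
move=> /andP[r0 rr'] Sx; have r'0 : 0 < r' by exact: lt_trans rr'.
have Sp y : (circle c r `|` circle c r') y ->
    exists a z, [/\ 0 < a <= r', unitc z & y = polar c a z].
  case=> [/(circleP _ _ r0)|/(circleP _ _ r'0)] [z uz ->].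
    by exists r, z; split=> //; rewrite r0 ltW.
  by exists r', z; split=> //; rewrite r'0 lexx.
split.
  move=> /(circleP _ _ r'0)[P uP ->] y z /Sp[a [A [/andP[a0 ha] uA ->]]]
    /Sp[b [B [/andP[b0 hb] uB ->]]].
  move=> /segment_polar[l hl]; rewrite /polar.
  have nA : normsq (a%:C * A) <= r' ^+ 2.
    by rewrite normsqM normsq_real [normsq A]uA mulr1 ler_pXn2r// nnegrE ltW.
  have nB : normsq (b%:C * B) <= r' ^+ 2.
    by rewrite normsqM normsq_real [normsq B]uB mulr1 ler_pXn2r// nnegrE ltW.
  move: nA nB; move: (a%:C * A) (b%:C * B) => X Y nX nY E.
  have : normsq (l%:C * X + (1 - l)%:C * Y) = r' ^+ 2.
    by rewrite -E normsqM normsq_real [normsq P]uP mulr1.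
  rewrite normsq_convex => Er; have XY0 := normsq_ge0 (X - Y).
  rewrite E.
  have [l0|l0] := eqVneq l 0; first by right; rewrite l0 subr0 mul0r mul1r add0r.
  have [l1|l1] := eqVneq l 1; first by left; rewrite l1 subrr mul0r mul1r addr0.
  have ll : 0 < l * (1 - l).
    have [la lb] := andP hl; apply: mulr_gt0; first by rewrite lt_def l0.
    by rewrite subr_gt0 lt_def eq_sym l1.
  have XY : X = Y.
    apply/eqP; rewrite -subr_eq0; apply/eqP/normsq_eq0.
    move: (normsq (X - Y)) (normsq X) (normsq Y) nX nY Er XY0 => d x1 y1; nra.
  by left; rewrite XY; congr (_ + ofC _); case: (Y) => y1 y2; simpc;
    congr (_ +i* _); ring.
case: Sx => // /(circleP _ _ r0)[P uP ->] /(_ (polar c r' P) (polar c r' (- P))) [].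
- by right; apply/circleP => //; exists P.
- by right; apply/circleP => //; exists (- P) => //; exact: unitcN.
- apply/segment_polar; exists ((1 + r / r') / 2).
    have k0 : 0 < r / r' by exact: divr_gt0.
    have k1 : r / r' < 1 by rewrite ltr_pdivrMr ?mul1r.
    lra.
  case: (P) => a b; simpc; congr (_ +i* _); field; rewrite gt_eqF//.
- by move=> E; move: rr'; rewrite (polar_radius (ltW r0) (ltW r'0) uP uP E) ltxx.
- by move=> E; move: rr'; rewrite (polar_radius (ltW r0) (ltW r'0) uP (unitcN uP) E) ltxx.
Qed.

End Plane.

(** * Extension to the plane *)

Section Extension.
Variable R : realType.
Implicit Types (c d : 'rV[R]_2) (f : 'rV[R]_2 -> 'rV[R]_2).

(** Being extreme is a betweenness property and characterizes the outer circle, so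
    f respects the two circles. *)
Lemma betweenness_circle_pair c d r r' rho rho' f : 0 < r < r' -> 0 < rho < rho' ->
  betweenness_isomorphism (circle c r `|` circle c r')
    (circle d rho `|` circle d rho') f ->
  exists g h, circle_pair_iso (r / r') (rho / rho') g h /\
    forall z, unitc z -> f (polar c r' z) = polar d rho' (g z) /\
                         f (polar c r z) = polar d rho (h z).
Proof.
move=> hr hrho fb; have [[fS fi fs] fseg] := fb.
have [/andP[r0 rr'] /andP[rho0 rhorho']] := (hr, hrho).
have r'0 := lt_trans r0 rr'; have rho'0 := lt_trans rho0 rhorho'.
have inS z : unitc z -> (circle c r `|` circle c r') (polar c r z).
  by move=> uz; left; apply/circleP => //; exists z.
have outS z : unitc z -> (circle c r `|` circle c r') (polar c r' z).
  by move=> uz; right; apply/circleP => //; exists z.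
have fout x : (circle c r `|` circle c r') x ->
    circle c r' x <-> circle d rho' (f x).
  move=> Sx; rewrite (extreme_outer hr Sx) (extreme_iso fb Sx).
  by rewrite (extreme_outer hrho (fS _ Sx)).
have disj z : unitc z -> ~ circle c r' (polar c r z).
  move=> uz /(circleP _ _ r'0)[w uw /(polar_radius (ltW r0) (ltW r'0) uz uw) E].
  by rewrite E ltxx in rr'.
have disj' z : unitc z -> ~ circle d rho' (polar d rho z).
  move=> uz /(circleP _ _ rho'0)[w uw /(polar_radius (ltW rho0) (ltW rho'0) uz uw) E].
  by rewrite E ltxx in rhorho'.
have [g gP] : {g : R[i] -> R[i] & forall z, unitc z ->
    unitc (g z) /\ f (polar c r' z) = polar d rho' (g z)}.
  apply: (@choice _ _ (fun z w => unitc z ->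
    unitc w /\ f (polar c r' z) = polar d rho' w)) => z.
  have [uz|nu] := pselect (unitc z); last by exists 0.
  have : circle c r' (polar c r' z) by apply/circleP => //; exists z.
  by move/(fout _ (outS _ uz))/(circleP _ _ rho'0) => [w uw E]; exists w.
have [h hP] : {h : R[i] -> R[i] & forall z, unitc z ->
    unitc (h z) /\ f (polar c r z) = polar d rho (h z)}.
  apply: (@choice _ _ (fun z w => unitc z ->
    unitc w /\ f (polar c r z) = polar d rho w)) => z.
  have [uz|nu] := pselect (unitc z); last by exists 0.
  have [/(circleP _ _ rho0)[w uw E]|] := fS _ (inS _ uz); first by exists w.
  by move/(fout _ (inS _ uz)) => /(disj _ uz).
exists g, h; split; last by move=> z uz; rewrite (gP _ uz).2 (hP _ uz).2.
have fI x y : (circle c r `|` circle c r') x -> (circle c r `|` circle c r') y ->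
    f x = f y -> x = y by move=> Sx Sy; apply: fi; rewrite inE.
split.
- by rewrite divr_gt0//= ltr_pdivrMr ?mul1r.
- by rewrite divr_gt0//= ltr_pdivrMr ?mul1r.
- by move=> A /gP[].
- by move=> A /hP[].
- move=> A B uA uB E; apply: (@polar_inj _ c _ _ _ (lt0r_neq0 r'0)).
  by apply: (fI _ _ (outS _ uA) (outS _ uB)); rewrite (gP _ uA).2 (gP _ uB).2 E.
- move=> A uA.
  have /fs[x Sx Ex] : (circle d rho `|` circle d rho') (polar d rho' A).
    by right; apply/circleP => //; exists A.
  have /(circleP _ _ r'0)[B uB xB] : circle c r' x.
    by apply/(fout _ Sx); rewrite Ex; apply/circleP => //; exists A.
  exists B => //; apply: (@polar_inj _ d _ _ _ (lt0r_neq0 rho'0)).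
  by rewrite -(gP _ uB).2 -xB.
- move=> A B uA uB E; apply: (@polar_inj _ c _ _ _ (lt0r_neq0 r0)).
  by apply: (fI _ _ (inS _ uA) (inS _ uB)); rewrite (hP _ uA).2 (hP _ uB).2 E.
- move=> A uA.
  have /fs[x Sx Ex] : (circle d rho `|` circle d rho') (polar d rho A).
    by left; apply/circleP => //; exists A.
  have [/(circleP _ _ r0)[B uB xB]|/(fout _ Sx)] := Sx; last first.
    by rewrite Ex => /(disj' _ uA).
  exists B => //; apply: (@polar_inj _ d _ _ _ (lt0r_neq0 rho0)).
  by rewrite -(hP _ uB).2 -xB.
- move=> A B P uA uB uP.
  rewrite -(segment_chord c hr uA uB uP).
  rewrite -(segment_chord d hrho (gP _ uA).1 (gP _ uB).1 (hP _ uP).1).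
  rewrite -(gP _ uA).2 -(gP _ uB).2 -(hP _ uP).2.
  by rewrite fseg//; [exact: inS|exact: outS|exact: outS].
Qed.

Lemma enormE (p : 'rV[R]_2) : enorm p = Num.sqrt (normsq (toC p)).
Proof. by rewrite -{1}[p]toCK enorm_ofC. Qed.

Definition similarity c d (C : R) (w : R[i]) (conj : bool) x : 'rV[R]_2 :=
  d + ofC (C%:C * (w * (if conj then cconj (toC (x - c)) else toC (x - c)))).

Lemma similarity_scaled c d C w conj : 0 < C -> unitc w ->
  scaled_isometry (similarity c d C w conj).
Proof.
move=> C0 uw; exists C => // x y.
rewrite !enormE /similarity opprD addrACA subrr add0r -ofCB ofCK.
rewrite -[in RHS](gtr0_norm C0) -sqrtr_sqr -sqrtrM ?sqr_ge0//; congr Num.sqrt.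
rewrite -!mulrBr !normsqM normsq_real [normsq w]uw mul1r; congr (_ * _).
rewrite !toCB; case: conj; last by congr normsq; ring.
by case: (toC x) (toC y) (toC c) => [? ?] [? ?] [? ?]; rewrite /normsq /=; ring.
Qed.

Lemma similarity_polar c d C w conj rho z :
  similarity c d C w conj (polar c rho z) =
  polar d (C * rho) (w * (if conj then cconj z else z)).
Proof.
rewrite /similarity /polar [c + _]addrC addrK ofCK; congr (_ + ofC _).
by rewrite realcM; case: conj; rewrite ?cconjM ?cconj_real; ring.
Qed.

(** The scaling factors agree because of two antipodal points.  Then Phi x and
    Psi x are equidistant from every point of the target circle, in particular
    from the ends of two perpendicular diameters, which fixes both
    coordinates. *)
Lemma scaled_isometry_unique c d r rho' f : 0 < r -> 0 < rho' ->
  forall S : set 'rV[R]_2, circle c r `<=` S -> circle d rho' `<=` f @` S ->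
  forall Phi Psi : 'rV[R]_2 -> 'rV[R]_2,
  scaled_isometry Phi -> scaled_isometry Psi ->
  (forall x, S x -> Phi x = f x) -> (forall x, S x -> Psi x = f x) ->
  Phi = Psi.
Proof.
move=> r0 rho'0 S cS dS Phi Psi [C C0 PhiC] [C' C'0 PsiC] PhiS PsiS.
have u1 : unitc (1 : R[i]) by rewrite /unitc /= expr0n expr1n addr0.
have CC : C = C'.
  have S1 : S (polar c r 1) by apply/cS/circleP => //; exists 1.
  have S2 : S (polar c r (-1)).
    by apply/cS/circleP => //; exists (-1) => //; exact: unitcN.
  have := PhiC (polar c r 1) (polar c r (-1)).
  have := PsiC (polar c r 1) (polar c r (-1)).
  rewrite !PhiS// !PsiS// => -> /mulIf -> //.
  rewrite enormE /polar opprD addrACA subrr add0r -ofCB ofCK -mulrBr normsqM normsq_real.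
  rewrite gt_eqF// sqrtr_gt0 mulr_gt0 ?exprn_gt0// /normsq /=; lra.
apply/funext => x.
have eqd z : unitc z -> normsq (toC (Phi x - d) - rho'%:C * z) =
                        normsq (toC (Psi x - d) - rho'%:C * z).
  move=> uz; have /dS[p Sp Ep] : circle d rho' (polar d rho' z).
    by apply/circleP => //; exists z.
  have := PhiC x p; rewrite CC -PsiC (PhiS _ Sp) (PsiS _ Sp) Ep.
  rewrite !enormE /polar !opprD !addrA.
  rewrite !(toCB _ (ofC _)) !ofCK => /eqP; rewrite eqr_sqrt ?normsq_ge0//.
  by move/eqP.
have ui : unitc (0 +i* 1 : R[i]) by rewrite /unitc /= expr0n expr1n add0r.
have := (eqd _ u1, eqd _ (unitcN u1), eqd _ ui, eqd _ (unitcN ui)).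
rewrite /normsq /= !mxE => -[[[e1 e2] e3] e4].
apply: row2P; apply: (mulfI (lt0r_neq0 rho'0)); lra.
Qed.

End Extension.

Theorem theorem4p1 (R : realType) (S T : set 'rV[R]_2)
    (hS : concentric_circles S) (hT : concentric_circles T)
    (f : 'rV[R]_2 -> 'rV[R]_2) (hf : betweenness_isomorphism S T f) :
  exists! Phi : 'rV[R]_2 -> 'rV[R]_2,
    scaled_isometry Phi /\ (forall x, S x -> Phi x = f x).
Proof.
have [c [r [r' [r0 rr' SE]]]] := hS; have [d [rho [rho' [rho0 rhorho' TE]]]] := hT.
have r'0 := lt_trans r0 rr'; have rho'0 := lt_trans rho0 rhorho'.
have [hr hrho] : (0 < r < r') /\ (0 < rho < rho') by rewrite r0 rho0.
rewrite SE TE in hf *.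
have [g [h [iso fE]]] := betweenness_circle_pair hr hrho hf.
have [kk [w [s [uw s1 gh]]]] := iso_rigid iso.
pose conj := s != 1.
have sE t : cis (s * t) = if conj then cconj (cis t) else cis t.
  rewrite /conj; move/eqP: s1; rewrite sqrf_eq1 => /orP[] /eqP ->.
    by rewrite eqxx mul1r.
  rewrite mulN1r cisN (unitcV (unitc_cis t)).
  by rewrite -subr_eq0 (_ : -1 - 1 = - 2); [rewrite oppr_eq0 pnatr_eq0|ring].
have C0 : 0 < rho' / r' by exact: divr_gt0.
pose Phi := similarity c d (rho' / r') w conj.
have isoPhi : scaled_isometry Phi by exact: similarity_scaled.
have PhiE x : (circle c r `|` circle c r') x -> Phi x = f x.
  move=> [/(circleP _ _ r0)|/(circleP _ _ r'0)] [z uz ->].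
    rewrite /Phi similarity_polar (fE _ uz).2; have [t _ ->] := unitc_cisP uz.
    rewrite (gh t).2 sE; congr polar.
    have -> : r = r / r' * r' by rewrite divfK// gt_eqF.
    by rewrite kk; field; rewrite !gt_eqF.
  rewrite /Phi similarity_polar (fE _ uz).1; have [t _ ->] := unitc_cisP uz.
  by rewrite (gh t).1 sE divfK// gt_eqF.
exists Phi; split=> // Psi [isoPsi PsiE].
apply: (@scaled_isometry_unique R c d r rho' f r0 rho'0
  (circle c r `|` circle c r')) => //.
by have [[_ _ fs] _] := hf; move=> y dy; apply: fs; right.
Qed.
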